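(* Let $\{u_{nm}\}_{0\le n\le m<\infty}$ be an arbitrary family of non-negative real numbers, and let $U:[-1,1]\setminus D\to[0,+\infty]$ be defined by $$U(x)=\sum_{0\le n\le m<+\infty}u_{nm}L_{nm}(x).$$ Then $U$ is non-negative, Lebesgue measurable, and even (i.e. $U(-x)=U(x)$ for all $x\in[-1,1]\setminus D$). Moreover, in $[0,+\infty]$, $$\int_{-1}^{1}U(x)\,dx=2\sum_{k=1}^{\infty}\ \sum_{\substack{m,n\ge 0\\ m-n=2k-1}}4^{-k}\binom{2k}{k}u_{nm},$$ and the essential supremum of $U$ on $[-1,1]$ is attained at $x=\pm\tfrac13$, with $$\|U\|_{L^\infty(-1,1)}=U\!\left(\pm\tfrac13\right)=\sum_{k=1}^{\infty}\ \sum_{\substack{m,n\ge 0\\ m-n=2k-1}}u_{nm}.$$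
   Context: Signed binary expansion: every $x\in[-1,1]$ can be written as $x=\sum_{n=0}^{\infty}x_n2^{-(n+1)}$ with digits $x_n\in\{-1,+1\}$; there is a countable set $D\subset[-1,1]$ (consisting of certain dyadic rationals) outside of which this expansion is unique. For $x\in[-1,1]\setminus D$ with digits $(x_n)_{n\ge0}$ and integers $0\le n\le m$, define the loop-counting function $L_{nm}(x)=1$ if $\sum_{j=n}^{m}x_j=0$ and $L_{nm}(x)=0$ otherwise. (Note $\pm\tfrac13\notin D$: $\tfrac13$ has digits $+1,-1,+1,-1,\dots$ and $-\tfrac13$ has digits $-1,+1,-1,+1,\dots$.) *)

(* Defs.v *)
From mathcomp Require Import all_boot all_order all_algebra.
From mathcomp Require Import all_classical all_reals all_analysis.
From mathcomp Require Import ess_sup_inf measurable_realfun.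
Import numFieldNormedType.Exports.
Import Order.TTheory GRing.Theory Num.Theory.

Set Implicit Arguments.
Unset Strict Implicit.
Unset Printing Implicit Defensive.

Local Open Scope classical_set_scope.
Local Open Scope ring_scope.

Section SignedBinary.
Variable R : realType.

Definition sdig (b : bool) : R := if b then 1 else -1.

Definition is_sexpansion (d : nat -> bool) (x : R) : Prop :=
  (fun N : nat => \sum_(n < N) sdig (d n) / 2 ^+ n.+1) @ \oo --> x.

Definition Dset : set R :=
  [set x | exists d1 d2, d1 <> d2 /\ is_sexpansion d1 x /\ is_sexpansion d2 x].

Definition dom : set R := `[(-1)%R, 1%R] `\` Dset.

(* the digits of x (the unique expansion when x \in [-1,1] \ D) *)
Definition sdigits (x : R) : nat -> bool :=
  get [set d | is_sexpansion d x].

Definition Lnm (n m : nat) (x : R) : R :=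
  if \sum_(n <= j < m.+1) sdig (sdigits x j) == 0 then 1 else 0.

Definition Ufun (u : nat -> nat -> R) (x : R) : \bar R :=
  (\esum_(p in [set p : nat * nat | (p.1 <= p.2)%N])
     ((u p.1 p.2)%:E * (Lnm p.1 p.2 x)%:E))%E.

End SignedBinary.

(* the real line with the sigma-algebra of Lebesgue measurable sets *)
Notation LebT R :=
  (caratheodory_type (R:=R) (@wlength R idfun)^*%mu).

(* Main.v *)
(** Fixing the first N digits confines x, up to the null set D, to an interval
of length 2 * 2^-N, so under Lebesgue measure the digits are independent fair
coins of total mass 2.  A window of length m - n + 1 can only have digit sum 0
when this length is even, say 2k, and then exactly 'C(2k, k) of the 4^k words
do; monotone convergence gives the integral.  The alternating digits of 1/3
close every window of even length, which gives the pointwise bound U <= U (1/3);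
conversely each finite partial sum of U (1/3) is a lower bound for U on a whole
cylinder around 1/3, a set of positive measure. *)
Require Import Defs.
From mathcomp Require Import all_boot all_order all_algebra.
From mathcomp Require Import all_classical all_reals all_analysis.
From mathcomp Require Import ess_sup_inf measurable_realfun.
From mathcomp Require Import lra ring zify.
Import numFieldNormedType.Exports.
Import Order.TTheory GRing.Theory Num.Theory.
Local Open Scope classical_set_scope.
Local Open Scope ring_scope.

(** * Partial sums of signed binary expansions *)

Definition psum (R : realType) (d : nat -> bool) (N : nat) : R :=
  \sum_(n < N) sdig R (d n) / 2 ^+ n.+1.

Definition catd (N : nat) (d e : nat -> bool) (n : nat) : bool :=
  if (n < N)%N then d n else e (n - N)%N.

Lemma sdigN (R : realType) (b : bool) : sdig R (~~ b) = - sdig R b.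
Proof. by case: b; rewrite /sdig /= ?opprK. Qed.

Lemma psumS (R : realType) d N :
  psum R d N.+1 = psum R d N + sdig R (d N) / 2 ^+ N.+1.
Proof. by rewrite /psum big_ord_recr. Qed.

Lemma eq_psum (R : realType) d e N :
  (forall j, (j < N)%N -> d j = e j) -> psum R d N = psum R e N.
Proof. by move=> de; apply: eq_bigr => i _; rewrite de. Qed.

Lemma psumN (R : realType) d N : psum R (fun n => ~~ d n) N = - psum R d N.
Proof.
by rewrite /psum -sumrN; apply: eq_bigr => i _; rewrite sdigN mulNr.
Qed.

(** Self-similarity: the digits after the first [N] form an expansion of their own, scaled by 2^-N.
    Shifting and concatenation both rest on this. *)
Lemma psum_add (R : realType) d N M :
  psum R d (N + M) = psum R d N + psum R (fun j => d (N + j)%N) M / 2 ^+ N.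
Proof.
elim: M => [|M IH]; first by rewrite addn0 /psum big_ord0 mul0r addr0.
rewrite addnS !psumS IH mulrDl -!mulrA -invfM -exprD.
by rewrite addrA addSn addnC.
Qed.

Lemma psum_cat (R : realType) d e N M :
  psum R (catd N d e) (N + M) = psum R d N + psum R e M / 2 ^+ N.
Proof.
rewrite psum_add; congr (_ + _ / _); apply: eq_psum => j; rewrite /catd.
  by move=> ->.
by move=> _; rewrite ltnNge leq_addr addKn.
Qed.

Lemma pow2V_gt0 (R : realType) N : 0 < (2 ^- N : R).
Proof. by rewrite invr_gt0 exprn_gt0. Qed.

Lemma norm_psum (R : realType) d N : `|psum R d N| <= 1 - 2 ^- N.
Proof.
elim: N => [|N IH]; first by rewrite /psum big_ord0 normr0 expr0 invr1 subrr.
rewrite psumS; apply: (le_trans (ler_normD _ _)).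
have : `|sdig R (d N) / 2 ^+ N.+1| = 2 ^- N.+1.
  rewrite normrM (gtr0_norm (pow2V_gt0 R _)).
  by case: (d N); rewrite /sdig ?normrN normr1 mul1r.
move=> ->; rewrite exprS invfM; have := pow2V_gt0 R N; lra.
Qed.

(** * Convergent expansions, their existence, and the dyadic exceptions *)

Lemma sexpansion_norm (R : realType) d (x : R) :
  is_sexpansion d x -> `|x| <= 1.
Proof.
move=> dx; have nx : `|psum R d N| @[N --> \oo] --> `|x| by exact: cvg_norm dx.
rewrite -(cvg_lim _ nx) //; apply: limr_le; first by apply/cvg_ex; exists `|x|.
near=> N; apply: (le_trans (norm_psum R d N)).
by have := pow2V_gt0 R N; lra.
Unshelve. all: by end_near. Qed.

Lemma sexpansion_shift (R : realType) d (x : R) N :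
  is_sexpansion d x ->
  is_sexpansion (fun j => d (N + j)%N) ((x - psum R d N) * 2 ^+ N).
Proof.
move=> dx; rewrite /is_sexpansion.
have -> : (fun M => \sum_(n < M) sdig R (d (N + n)%N) / 2 ^+ n.+1) =
          (fun M => (psum R d (M + N) - psum R d N) * 2 ^+ N).
  apply/funext => M; rewrite addnC psum_add.
  transitivity (psum R (fun j => d (N + j)%N) M) => //; field.
  by rewrite expf_neq0.
apply: cvgM; last exact: cvg_cst.
apply: cvgB; last exact: cvg_cst.
by rewrite cvg_shiftn; exact: dx.
Qed.

Lemma sexpansion_cat (R : realType) d e (x : R) N :
  is_sexpansion e x -> is_sexpansion (catd N d e) (psum R d N + x / 2 ^+ N).
Proof.
move=> ex; rewrite /is_sexpansion -(cvg_shiftn N).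
have -> : [sequence \sum_(i < n + N) sdig R (catd N d e i) / 2 ^+ i.+1]_n =
          (fun M => psum R d N + psum R e M / 2 ^+ N).
  by apply/funext => M; rewrite -psum_cat addnC.
apply: cvgD; first exact: cvg_cst.
by apply: cvgM; [exact: ex | exact: cvg_cst].
Qed.

Lemma sexpansionN (R : realType) d (x : R) :
  is_sexpansion d x -> is_sexpansion (fun n => ~~ d n) (- x).
Proof.
move=> dx; rewrite /is_sexpansion.
rewrite (_ : (fun N => _) = (fun N => - psum R d N)).
  exact: cvgN dx.
by apply/funext => N; rewrite -psumN.
Qed.

(** The remainder rescaled by 2^N is itself the value of the shifted expansion, hence lies in
    [-1,1]. *)
Lemma sexpansion_dist (R : realType) d (x : R) N :
  is_sexpansion d x -> `|x - psum R d N| <= 2 ^- N.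
Proof.
move=> /(sexpansion_shift _ d x N)/sexpansion_norm.
rewrite normrM [`|2 ^+ N|]gtr0_norm ?exprn_gt0 //.
by rewrite -ler_pdivlMr ?exprn_gt0 // mul1r.
Qed.

(** Converse of [sexpansion_dist]: it reduces convergence to an estimate for each [N], as needed for
    the greedy digits and for the digits of 1/3. *)
Lemma sexpansion_intro (R : realType) d (x : R) :
  (forall N, `|x - psum R d N| <= 2 ^- N) -> is_sexpansion d x.
Proof.
move=> H; apply/cvgrPdist_le => e e0.
have : (fun N => 2 ^- N : R) @ \oo --> (0 : R).
  under eq_fun do rewrite -exprVn.
  by apply: cvg_expr; rewrite ger0_norm //; lra.
move=> /cvgrPdist_le /(_ _ e0); apply: filterS => N /=.
rewrite sub0r normrN (gtr0_norm (pow2V_gt0 R _)); exact: le_trans (H N).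
Qed.

(* [sdig_rem x n] is 2^n times the error left by the first n greedy digits. *)
Fixpoint sdig_rem (R : realType) (x : R) (n : nat) : R :=
  if n is n'.+1 then 2 * sdig_rem R x n' - sdig R (0 <= sdig_rem R x n')
  else x.

(** Greedy algorithm: the digit is the sign of the current remainder r, and the map sending r to 2r
    - 1 for r >= 0 and to 2r + 1 for r < 0 preserves [-1,1]. *)
Lemma sexpansion_exists (R : realType) (x : R) :
  `|x| <= 1 -> exists d, is_sexpansion d x.
Proof.
move=> x1; exists (fun n => 0 <= sdig_rem R x n).
have rem1 n : `|sdig_rem R x n| <= 1.
  elim: n => //= n; set r := sdig_rem _ _ _; rewrite !ler_norml => /andP[? ?].
  by case: (lerP 0 r) => ?; rewrite /sdig; lra.
have remE n : x - psum R (fun n => 0 <= sdig_rem R x n) n =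
              sdig_rem R x n / 2 ^+ n.
  elim: n => [|n IH]; first by rewrite /psum big_ord0 expr0 subr0 divr1.
  rewrite psumS opprD addrA IH /= exprS; field.
  by rewrite expf_neq0.
apply: sexpansion_intro => N; rewrite remE normrM (gtr0_norm (pow2V_gt0 R _)).
by rewrite ler_piMl // ltW // pow2V_gt0.
Qed.

(* At the first index N where two expansions of x differ, x is within
   2^-(N+1) of both [psum d N + 2^-(N+1)] and [psum d N - 2^-(N+1)]. *)
Lemma Dset_dyadic (R : realType) (x : R) :
  Dset x -> exists d N, x = psum R d N.
Proof.
move=> [d [e [de [dx ex]]]].
have [n ne] : exists n, ~ (d n == e n).
  apply/existsNP => H; apply: de; apply/funext => n; exact/eqP/H.
have exn : exists n, d n != e n by exists n; exact/negP.
case: (ex_minnP exn) => N neN minN.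
have eqd : psum R d N = psum R e N.
  apply: eq_psum => j jN; apply/eqP; apply: contraTT jN => /minN.
  by rewrite -leqNgt.
exists d, N.
have := sexpansion_dist _ _ _ N.+1 dx; have := sexpansion_dist _ _ _ N.+1 ex.
rewrite !psumS -eqd.
move: neN; set t := 2 ^+ _; set s := psum _ _ _.
have t0 : 0 < t^-1 by exact: pow2V_gt0.
case: (d N); case: (e N) => // _; rewrite /sdig !ler_norml ?mulN1r ?mul1r;
  move=> /andP[? ?] /andP[? ?]; apply/eqP; rewrite eq_le; apply/andP; lra.
Qed.

(** A partial sum depends only on a finite word of digits, and there are countably many such
    words. *)
Lemma countable_Dset (R : realType) : countable (@Dset R).
Proof.
pose f (s : seq bool) := psum R (nth false s) (size s).
apply: (@sub_countable _ _ _ (f @` [set: seq bool])); last first.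
  exact: card_le_trans (card_image_le _ _) (countableP _).
apply: subset_card_le => x /Dset_dyadic [d [N ->]].
exists (mkseq d N) => //; rewrite /f size_mkseq; apply: eq_psum => j jN.
by rewrite nth_mkseq.
Qed.

(** * Digits of points of [dom], and reflection *)

Lemma sdigitsP (R : realType) (x : R) : dom x -> is_sexpansion (sdigits x) x.
Proof.
move=> [x1 _]; apply: (@getPex _ [set d | is_sexpansion d x]).
by apply: sexpansion_exists; rewrite ler_norml; move: x1; rewrite /= in_itv.
Qed.

Lemma sdigits_unique (R : realType) (x : R) d :
  dom x -> is_sexpansion d x -> sdigits x = d.
Proof.
move=> dx ex; apply: contrapT => ne; have [_ []] := dx.
by exists (sdigits x), d; split=> //; split=> //; exact: sdigitsP.
Qed.

Lemma domN (R : realType) (x : R) : dom x -> dom (- x).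
Proof.
move=> [x1 nx]; split.
  by move: x1; rewrite /= !in_itv /= lerN2 lerNl andbC.
move=> [d [e [de [dx ex]]]]; apply: nx.
exists (fun n => ~~ d n), (fun n => ~~ e n); split.
  move=> H; apply: de; apply/funext => n.
  by apply: negb_inj; exact: (congr1 (@^~ n) H).
by rewrite -[x]opprK; split; exact: sexpansionN.
Qed.

Lemma sdigitsN (R : realType) (x : R) :
  dom x -> sdigits (- x) = (fun n => ~~ sdigits x n).
Proof.
move=> dx; apply: sdigits_unique; first exact: domN.
exact/sexpansionN/sdigitsP.
Qed.

Lemma LnmN (R : realType) n m (x : R) : dom x -> Lnm n m (- x) = Lnm n m x.
Proof.
move=> dx; rewrite /Lnm sdigitsN //.
by under eq_bigr do rewrite sdigN; rewrite sumrN oppr_eq0.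
Qed.

(** * Cylinders as intervals *)

Definition cyl (R : realType) (d : nat -> bool) (N : nat) : set R :=
  [set x | dom x /\ forall j, (j < N)%N -> sdigits x j = d j].

Lemma cylE (R : realType) d N :
  cyl R d N = `[psum R d N - 2 ^- N, psum R d N + 2 ^- N] `\` @Dset R.
Proof.
have p0 := pow2V_gt0 R N.
apply/seteqP; split=> x.
  move=> [dx xd]; split; last by case: dx.
  have := sexpansion_dist _ _ _ N (sdigitsP _ _ dx).
  rewrite (eq_psum _ _ d) // ler_norml /= in_itv /= => /andP[? ?].
  by apply/andP; lra.
move=> [/=]; rewrite in_itv /= => /andP[x1 x2] nx.
have dx : dom x.
  split=> //; have := norm_psum R d N; rewrite ler_norml /= in_itv /=.
  by move=> /andP[? ?]; apply/andP; lra.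
split=> // j jN.
(* Expand the rescaled remainder and prefix the first [N] digits of [d]: this is an expansion of
   [x], so by uniqueness it gives the digits of [x]. *)
have [|e ee] := @sexpansion_exists R ((x - psum R d N) * 2 ^+ N).
  rewrite normrM [`|2 ^+ N|]gtr0_norm ?exprn_gt0 //.
  rewrite -ler_pdivlMr ?exprn_gt0 // mul1r ler_norml; apply/andP; lra.
have := sexpansion_cat _ d _ _ N ee.
rewrite mulfK ?expf_neq0 // addrC subrK => /sdigits_unique -> //.
by rewrite /catd jN.
Qed.

(** * The point 1/3 *)

Definition alt (n : nat) : bool := ~~ odd n.

(** Geometric sum with first term 1/2 and ratio -1/2. *)
Lemma psum_alt (R : realType) N : psum R alt N = (1 - (- 1 / 2) ^+ N) / 3.
Proof.
elim: N => [|N IH]; first by rewrite /psum big_ord0 expr0 subrr mul0r.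
rewrite psumS IH.
have -> : sdig R (alt N) = (- 1) ^+ N.
  by rewrite /alt /sdig -signr_odd; case: (odd N).
rewrite !expr_div_n !exprS; field.
by rewrite expf_neq0.
Qed.

Lemma sexpansion_alt (R : realType) : is_sexpansion alt (1 / 3 : R).
Proof.
apply: sexpansion_intro => N; rewrite psum_alt.
rewrite (_ : _ - _ = (- 1 / 2) ^+ N / 3); last by field.
rewrite normrM normrX normrM normrN1 mul1r !gtr0_norm ?invr_gt0 // exprVn.
by have := pow2V_gt0 R N; lra.
Qed.

Lemma psum_int (R : realType) d N :
  exists z : int, psum R d N * 2 ^+ N = z%:~R.
Proof.
elim: N => [|N [z IH]]; first by exists 0; rewrite /psum big_ord0 mul0r.
exists (2 * z + if d N then 1 else -1).
rewrite psumS mulrDl divfK ?expf_neq0 // exprS mulrCA IH intrD intrM.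
by rewrite /sdig; case: (d N).
Qed.

(** Points of [Dset] are dyadic; if 1/3 were, then 2^N / 3 would be an integer for some [N], and 3
    would divide 2^N. *)
Lemma third_notin_Dset (R : realType) : ~ Dset (1 / 3 : R).
Proof.
move=> /Dset_dyadic [d [N E]]; have [z] := psum_int R d N.
rewrite -E => Hz.
have : (2 ^ N)%:R = (3 * z)%:~R :> R.
  by rewrite intrM -Hz natrX; field.
rewrite -[(2 ^ N)%:R]/((2 ^ N)%N%:Z%:~R) => /intr_inj H.
have /(congr1 absz) := H; rewrite abszM /= => H3.
have : (3 %| 2 ^ N)%N by rewrite H3 dvdn_mulr.
by rewrite Euclid_dvdX.
Qed.

Lemma dom_third (R : realType) : dom (1 / 3 : R).
Proof.
split; last exact: third_notin_Dset.
by rewrite /= in_itv /=; apply/andP; lra.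
Qed.

Lemma sdigits_third (R : realType) : sdigits (1 / 3 : R) = alt.
Proof.
by apply: sdigits_unique; [exact: dom_third | exact: sexpansion_alt].
Qed.

(** * Measurability and the measure of cylinders *)

Lemma measurable_LebT (R : realType) (A : set R) :
  measurable (A : set (measurableTypeR R)) -> measurable (A : set (LebT R)).
Proof. exact: sub_caratheodory. Qed.

Lemma measurable_itv_LebT (R : realType) (i : interval R) :
  measurable ([set` i] : set (LebT R)).
Proof. by apply: measurable_LebT; exact: measurable_itv. Qed.

Lemma measurable_Dset (R : realType) : measurable (@Dset R : set (LebT R)).
Proof.
apply: measurable_LebT; apply: countable_measurable; last exact: countable_Dset.
by move=> t; exact: measurable_set1.
Qed.

Lemma measurable_dom (R : realType) : measurable (@dom R : set (LebT R)).
Proof.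
by apply: measurableD; [exact: measurable_itv_LebT | exact: measurable_Dset].
Qed.

Lemma completed_lebesgue_measure_itvD (R : realType) (i : interval R) :
  @completed_lebesgue_measure R ([set` i] `\` @Dset R) =
  lebesgue_measure ([set` i] : set R).
Proof.
have Di0 : @completed_lebesgue_measure R ([set` i] `&` @Dset R) = 0%E.
  apply: (@countable_lebesgue_measure0 R).
  by apply: sub_countable (countable_Dset R); apply: subset_card_le => x [].
have E := @measureDI _ (LebT R) R (@completed_lebesgue_measure R) [set` i]
  (@Dset R) (measurable_itv_LebT R i) (measurable_Dset R).
apply/esym; apply: (etrans E); rewrite -[RHS]adde0; congr (_ + _)%E.
exact: Di0.
Qed.

Lemma cyl_measure (R : realType) d N :
  measurable (cyl R d N : set (LebT R)) /\
  @completed_lebesgue_measure R (cyl R d N) = (2 / 2 ^+ N)%:E.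
Proof.
rewrite cylE; split.
  by apply: measurableD; [exact: measurable_itv_LebT | exact: measurable_Dset].
rewrite completed_lebesgue_measure_itvD lebesgue_measure_itv /= lte_fin.
have p0 := pow2V_gt0 R N.
rewrite ifT; last lra.
by rewrite -EFinB; congr (_%:E); ring.
Qed.

(** * Independence of the digits, by counting words *)

(** The number of Boolean words of length [N] satisfying [P]; recursion on the first letter mirrors
    the splitting of a cylinder into two halves. *)
Fixpoint words (N : nat) (P : pred (seq bool)) : nat :=
  if N is N'.+1 then
    words N' (fun s => P (true :: s)) + words N' (fun s => P (false :: s))
  else P [::].

Lemma mkseq_cons (T : Type) (f : nat -> T) N :
  mkseq f N.+1 = f 0%N :: mkseq (fun n => f n.+1) N.
Proof. by rewrite /mkseq /= (iotaDl 1) -map_comp. Qed.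

(** Keeping a fixed prefix [w] apart from the [N] digits tested by [P] lets an induction on [N] move
    one digit at a time into the prefix. *)
Definition digit_set (R : realType) (w : seq bool) N (P : pred (seq bool)) :
    set R :=
  [set x | dom x /\ mkseq (sdigits x) (size w) = w /\
           P (mkseq (fun j => sdigits x (size w + j)%N) N)].

(** Splitting on the digit that follows [w] gives two disjoint sets of the same kind with one tested
    digit fewer; with none left, the set is a cylinder or empty. *)
Lemma digit_set_measure (R : realType) w N P :
  measurable (digit_set R w N P : set (LebT R)) /\
  @completed_lebesgue_measure R (digit_set R w N P) =
    (2 / 2 ^+ (size w + N) * (words N P)%:R)%:E.
Proof.
elim: N w P => [|N IH] w P.
  rewrite addn0 /=; case: (boolP (P [::])) => P0; last first.
    rewrite (_ : digit_set _ _ _ _ = set0) ?mulr0; last first.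
      by apply/seteqP; split=> x //= [_ [_ H]]; rewrite H in P0.
    by split; [exact: measurable0 | exact: measure0].
  rewrite (_ : digit_set _ _ _ _ = cyl R (nth false w) (size w)) ?mulr1.
    exact: cyl_measure.
  apply/seteqP; split=> x.
    by move=> [dx [xw _]]; split=> // j jw; rewrite -[in RHS]xw nth_mkseq.
  move=> [dx xw]; split=> //; split=> //.
  apply: (@eq_from_nth _ false); rewrite size_mkseq // => j jw.
  by rewrite nth_mkseq // xw.
have step b : digit_set R (rcons w b) N (fun s => P (b :: s)) =
    digit_set R w N.+1 P `&` [set x | sdigits x (size w) = b].
  apply/seteqP; split=> x;
    rewrite /digit_set /= size_rcons [mkseq _ (size w).+1]mkseqS.
    move=> [dx [/rcons_inj [xw xb] xP]]; split=> //; split=> //; split=> //.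
    rewrite mkseq_cons addn0 xb; move: xP; congr (P (_ :: _)).
    by apply: eq_mkseq => j; rewrite addSnnS.
  move=> [[dx [xw xP]] xb]; split=> //; split; first by rewrite xw xb.
  move: xP; rewrite mkseq_cons addn0 xb; congr (P (_ :: _)).
  by apply: eq_mkseq => j; rewrite addSnnS.
have -> : digit_set R w N.+1 P =
    digit_set R (rcons w true) N (fun s => P (true :: s)) `|`
    digit_set R (rcons w false) N (fun s => P (false :: s)).
  apply/seteqP; split=> x; rewrite !step.
    by move=> ?; case E : (sdigits x (size w)); [left | right].
  by move=> [] [].
have [mt vt] := IH (rcons w true) (fun s => P (true :: s)).
have [mf vf] := IH (rcons w false) (fun s => P (false :: s)).
split; first exact: measurableU.
rewrite measureU //; last first.
  rewrite !step; apply/seteqP; split=> x //.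
  by move=> [[_ /= ->] [_ /=]].
transitivity (@completed_lebesgue_measure R
   (digit_set R (rcons w true) N (fun s => P (true :: s))) +
  @completed_lebesgue_measure R
   (digit_set R (rcons w false) N (fun s => P (false :: s))))%E => //.
by rewrite vt vf !size_rcons addSnnS /= natrD -EFinD mulrDr.
Qed.

(** Each dropped letter is free and doubles the count. *)
Lemma words_drop n N (P : pred (seq bool)) :
  words (n + N) (fun s => P (drop n s)) = (2 ^ n * words N P)%N.
Proof.
elim: n => [|n IH].
  by rewrite mul1n; congr words; apply/funext => s; rewrite drop0.
by rewrite addSn /= IH expnS -mulnA mul2n addnn.
Qed.

Lemma words_pred0 N : words N pred0 = 0%N.
Proof. by elim: N => //= N ->. Qed.

(** Splitting on the first letter is Pascal's rule. *)
Lemma words_count N k :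
  words N (fun s => count id s == k) = 'C(N, k).
Proof.
elim: N k => [|N IH] [|k] //=.
  (* For [k = 0] no word starting with [true] qualifies, so that branch counts nothing. *)
  rewrite IH bin0 (_ : (fun s => _) = pred0) ?words_pred0 //.
by rewrite binS -(IH k) -(IH k.+1) addnC.
Qed.

(** * Loops as balanced words *)

Lemma sum_sdig (R : realType) (d : nat -> bool) (s : seq nat) :
  \sum_(j <- s) sdig R (d j) =
  2 * (count id [seq d j | j <- s])%:R - (size s)%:R.
Proof.
elim: s => [|j s IH]; first by rewrite big_nil mulr0 subr0.
rewrite big_cons IH /= natrD -[(size s).+1]addn1 natrD /sdig.
by case: (d j); rewrite /=; ring.
Qed.

Lemma drop_mkseq (T : Type) (f : nat -> T) n N :
  drop n (mkseq f N) = [seq f j | j <- index_iota n N].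
Proof. by rewrite /mkseq -map_drop drop_iota add0n. Qed.

Lemma sum_sdig_eq0 (R : realType) (d : nat -> bool) n m :
  (\sum_(n <= j < m) sdig R (d j) == 0) =
  ((count id (drop n (mkseq d m))).*2 == m - n)%N.
Proof.
rewrite sum_sdig drop_mkseq size_iota subr_eq0 -natrM eqr_nat.
by rewrite mul2n.
Qed.

(** The window has [m - n + 1] digits, so an even gap makes its length odd, and an odd number of
    signs cannot cancel. *)
Lemma Lnm_odd (R : realType) n m (x : R) : ~~ odd (m - n) -> (n <= m)%N ->
  Lnm n m x = 0.
Proof.
move=> o nm; rewrite /Lnm sum_sdig_eq0; case: eqP => // E.
by move: o; rewrite -[odd _]negbK -oddS -subSn // -E odd_double.
Qed.

Lemma Lnm_third (R : realType) n m : odd (m - n) ->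
  Lnm n m (1 / 3 : R) = 1.
Proof.
move=> o; rewrite /Lnm sdigits_third.
rewrite (_ : \sum_(n <= j < m.+1) _ = 0) ?eqxx //.
have nm : (n < m)%N by rewrite -subn_gt0; case: (m - n)%N o.
have alt2 k : \sum_(n <= j < n + k.*2) sdig R (alt j) = 0.
  elim: k => [|k IH]; first by rewrite addn0 big_geq.
  rewrite doubleS !addnS !big_nat_recr /=; try lia.
  by rewrite IH /alt /= /sdig; case: (odd _) => /=; ring.
(* An odd gap means an even number of digits, which cancel in consecutive pairs. *)
have -> : m.+1 = (n + (m - n).+1./2.*2)%N; last exact: alt2.
by have := odd_double_half (m - n).+1; rewrite oddS o /=; lia.
Qed.

(** The restriction to [dom] matters: elsewhere [sdigits] is an arbitrary choice. *)
Definition Lset (R : realType) (n m : nat) : set R :=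
  [set x | dom x /\ Lnm n m x = 1].

Lemma LsetE (R : realType) n m : (n <= m)%N ->
  Lset R n m = digit_set R [::] m.+1
    (fun s => (count id (drop n s)).*2 == (m - n).+1).
Proof.
move=> nm; apply/seteqP; split=> x [dx H]; split=> //; move: H.
  rewrite /Lnm sum_sdig_eq0 subSn //; case: ifP => [|_ /esym/eqP].
    by [].
  by rewrite oner_eq0.
by move=> [_ H]; rewrite /Lnm sum_sdig_eq0 subSn // ifT.
Qed.

Lemma measurable_Lset (R : realType) n m : (n <= m)%N ->
  measurable (Lset R n m : set (LebT R)).
Proof.
by move=> nm; rewrite LsetE //; exact: (digit_set_measure R [::] m.+1 _).1.
Qed.

(** Among the 2^(n + 2k) words of the first n + 2k digits, the first n letters are free and the last
    2k are balanced, so 2^n 'C(2k, k) words qualify. *)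
Lemma Lset_measure (R : realType) n k : (0 < k)%N ->
  @completed_lebesgue_measure R (Lset R n (n + (2 * k - 1))) =
  (2 * (4 ^- k * ('C(2 * k, k))%:R))%:E.
Proof.
move=> k0; rewrite LsetE ?leq_addr //.
have -> : (n + (2 * k - 1)).+1 = (n + 2 * k)%N by lia.
have -> : (n + (2 * k - 1) - n).+1 = k.*2 by lia.
rewrite (digit_set_measure R [::] _ _).2 add0n.
rewrite (words_drop n (2 * k) (fun s => (count id s).*2 == k.*2)).
rewrite (_ : (fun s => _) = (fun s => count id s == k)); last first.
  by apply/funext => s; rewrite eqn_leq !leq_double -eqn_leq.
rewrite words_count natrM natrX exprD exprM.
rewrite (_ : 2 ^+ 2 = 4 :> R); last by ring.
congr (_%:E); field.
by rewrite !expf_neq0.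
Qed.

(** * Rearranging sums over pairs *)

(** Puts the sum in the form of iterated series, to which measurability and monotone convergence for
    series apply. *)
Lemma esum_nneseries2 (R : realType) (a : nat * nat -> \bar R) :
  (forall p, (p.1 <= p.2)%N -> (0 <= a p)%E) ->
  (\esum_(p in [set p : nat * nat | (p.1 <= p.2)%N]) a p =
   \sum_(n <oo) \sum_(m <oo) if (n <= m)%N then a (n, m) else 0)%E.
Proof.
move=> a0.
transitivity (\sum_(n <oo) \sum_(m <oo | (n <= m)%N) a (n, m))%E; last first.
  by apply: eq_eseriesr => n _; rewrite eseries_mkcond.
rewrite nneseries_esumT; last first.
  by move=> n; apply: nneseries_ge0 => m _ /(a0 (n, m)).
transitivity (\esum_(n in [set: nat])
  \esum_(m in [set m | (n <= m)%N]) a (n, m))%E.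
  rewrite esum_esum; last by move=> n m _ /(a0 (n, m)).
  rewrite (_ : [set: nat] `*`` _ = [set p : nat * nat | (p.1 <= p.2)%N]).
    by apply: eq_esum => -[n m].
  by apply/seteqP; split=> p //= [].
apply: eq_esum => n _; rewrite nneseries_esum // => m; exact: (a0 (n, m)).
Qed.

(** The diagonals of gap 2k - 1 with k >= 1 are disjoint and together cover exactly the pairs of odd
    gap, outside which [a] vanishes. *)
Lemma esum_odd_gap (R : realType) (a : nat * nat -> \bar R) :
  (forall p, (p.1 <= p.2)%N -> (0 <= a p)%E) ->
  (forall p, (p.1 <= p.2)%N -> ~~ odd (p.2 - p.1) -> a p = 0%E) ->
  (\esum_(p in [set p : nat * nat | (p.1 <= p.2)%N]) a p =
   \sum_(1 <= k <oo)
      \esum_(p in [set p : nat * nat |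
                   (p.1 <= p.2)%N /\ p.2 = (p.1 + (2 * k - 1))%N]) a p)%E.
Proof.
move=> a0 aeven; rewrite eseries_cond nneseries_esum; last first.
  by move=> k _; apply: esum_ge0 => p [/a0].
pose A k := [set p : nat * nat |
  (p.1 <= p.2)%N /\ p.2 = (p.1 + (2 * k - 1))%N].
transitivity
  (\esum_(p in \bigcup_(k in [set k | true && (0 < k)%N]) A k) a p)%E.
  rewrite (_ : \bigcup_(k in _) A k =
      [set p | (p.1 <= p.2)%N] `&` [set p | odd (p.2 - p.1)]).
    rewrite esum_mkcondr; apply: eq_esum => p p12.
    by case: ifPn => // /negP; rewrite inE /= => /negP; exact: aeven.
  apply/seteqP; split=> -[n m].
    move=> [k /= k0 [/= nm ->]]; split=> /=; first exact: leq_addr.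
    by rewrite addKn oddB ?oddM //=; lia.
  (* Half the length [m - n + 1] of the window. *)
  move=> [/= nm o]; exists (m - n).+1./2.
    by rewrite /=; have := odd_double_half (m - n).+1; rewrite oddS o /=; lia.
  split=> //=.
  by have := odd_double_half (m - n).+1; rewrite oddS o /=; lia.
rewrite esum_bigcup //; last by move=> p [k _ [/a0]].
by move=> i j _ _ [[n m] [[_ /= mi] [_ /= mj]]]; lia.
Qed.

(** * The loop-counting functions and their integrals *)

Lemma LnmE (R : realType) n m (x : R) : dom x -> Lnm n m x = \1_(Lset R n m) x.
Proof.
move=> dx; rewrite indicE; case: (boolP (x \in Lset R n m)).
  by rewrite inE => -[].
move=> /negP nL; rewrite /Lnm; case: eqP => // E; exfalso; apply: nL.
by rewrite inE; split=> //; rewrite /Lnm E eqxx.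
Qed.

Lemma Lnm_ge0 (R : realType) n m (x : R) : 0 <= Lnm n m x.
Proof. by rewrite /Lnm; case: ifP. Qed.

Lemma Lnm_le_third (R : realType) n m (x : R) : (n <= m)%N ->
  Lnm n m x <= Lnm n m (1 / 3 : R).
Proof.
move=> nm; case: (boolP (odd (m - n))) => o; last by rewrite !Lnm_odd.
by rewrite Lnm_third // /Lnm; case: ifP.
Qed.

Lemma eq_Lnm (R : realType) n m (x y : R) :
  (forall j, (j <= m)%N -> sdigits x j = sdigits y j) ->
  Lnm n m x = Lnm n m y.
Proof.
move=> xy; rewrite /Lnm (_ : \sum_(n <= j < m.+1) sdig R (sdigits x j) =
  \sum_(n <= j < m.+1) sdig R (sdigits y j)) //.
by apply: eq_big_nat => j /andP[_ jm]; rewrite xy.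
Qed.

(** For [n <= m], the probability that a simple random walk is back at its start after [m - n + 1]
    steps. *)
Definition loop_freq (R : realType) (n m : nat) : R :=
  if odd (m - n) then
    let k := (m - n).+1./2 in 4 ^- k * ('C(2 * k, k))%:R
  else 0.

Lemma loop_freq_odd (R : realType) n k : (0 < k)%N ->
  loop_freq R n (n + (2 * k - 1)) = 4 ^- k * ('C(2 * k, k))%:R.
Proof.
move=> k0; rewrite /loop_freq addKn.
have -> : (2 * k - 1).+1./2 = k by lia.
by rewrite ifT //; lia.
Qed.

Lemma loop_freq_ge0 (R : realType) n m : 0 <= loop_freq R n m.
Proof.
by rewrite /loop_freq; case: ifP.
Qed.

Lemma Lset_loop_freq (R : realType) n m : (n <= m)%N ->
  @completed_lebesgue_measure R (Lset R n m) = (2 * loop_freq R n m)%:E.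
Proof.
move=> nm; case: (boolP (odd (m - n))) => o.
  have E : m = (n + (2 * (m - n).+1./2 - 1))%N by lia.
  by rewrite {1 2}E loop_freq_odd ?Lset_measure //; lia.
rewrite /loop_freq (negbTE o) mulr0 (_ : Lset R n m = set0) ?measure0 //.
apply/seteqP; split=> x // [_]; rewrite Lnm_odd // => /esym/eqP.
by rewrite oner_eq0.
Qed.

Lemma measurable_Lnm (R : realType) n m : (n <= m)%N ->
  measurable_fun (@dom R : set (LebT R)) (Lnm n m : LebT R -> R).
Proof.
move=> nm; apply: (eq_measurable_fun (\1_(Lset R n m) : LebT R -> R)).
  by move=> x; rewrite inE => dx; rewrite LnmE.
exact/measurable_indic/measurable_Lset.
Qed.

Lemma integral_Lnm (R : realType) n m (c : R) : (n <= m)%N -> 0 <= c ->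
  (\int[@completed_lebesgue_measure R]_(x in (@dom R : set (LebT R)))
    (c%:E * (Lnm n m x)%:E))%E = (2%:E * (loop_freq R n m * c)%:E)%E.
Proof.
move=> nm c0; have mL := measurable_Lset R n m nm.
rewrite ge0_integralZl_EFin; first last.
- exact: c0.
- by apply/measurable_EFinP; exact: measurable_Lnm.
- by move=> x _; rewrite lee_fin Lnm_ge0.
- exact: measurable_dom.
transitivity (c%:E * \int[@completed_lebesgue_measure R]_(x in
  (@dom R : set (LebT R))) (\1_(Lset R n m : set (LebT R)) x)%:E)%E.
  congr (_ * _)%E; apply: eq_integral => x; rewrite inE => dx.
  by rewrite LnmE.
rewrite integral_indic //; last exact: measurable_dom.
rewrite setIidl; last by move=> x [].
transitivity (c%:E * @completed_lebesgue_measure R (Lset R n m))%E => //.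
by rewrite Lset_loop_freq // -!EFinM; congr (_%:E); ring.
Qed.

(** * Measurability and integral of [Ufun] *)

Lemma Ufun_nneseries (R : realType) (u : nat -> nat -> R) (x : R) :
  (forall n m, (n <= m)%N -> 0 <= u n m) ->
  Ufun u x = (\sum_(n <oo) \sum_(m <oo)
    if (n <= m)%N then (u n m)%:E * (Lnm n m x)%:E else 0)%E.
Proof.
move=> u0; rewrite /Ufun esum_nneseries2 // => p p12.
by rewrite mule_ge0 // lee_fin ?u0 ?Lnm_ge0.
Qed.

Lemma Uterm_ge0 (R : realType) (u : nat -> nat -> R) n m (x : R) :
  (forall n m, (n <= m)%N -> 0 <= u n m) ->
  (0 <= if (n <= m)%N then (u n m)%:E * (Lnm n m x)%:E else 0)%E.
Proof.
by move=> u0; case: ifP => // nm; rewrite mule_ge0 // lee_fin ?u0 ?Lnm_ge0.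
Qed.

Lemma measurable_Uterm (R : realType) (u : nat -> nat -> R) n m :
  measurable_fun (@dom R : set (LebT R))
    ((fun x => if (n <= m)%N then (u n m)%:E * (Lnm n m x)%:E else 0)%E
       : LebT R -> \bar R).
Proof.
case E: (n <= m)%N; last exact: measurable_cst.
apply: measurable_funeM; apply/measurable_EFinP; exact: measurable_Lnm.
Qed.

Lemma measurable_inner_series (R : realType) (u : nat -> nat -> R) n :
  (forall n m, (n <= m)%N -> 0 <= u n m) ->
  measurable_fun (@dom R : set (LebT R))
    ((fun x => \sum_(m <oo)
        if (n <= m)%N then (u n m)%:E * (Lnm n m x)%:E else 0)%E
       : LebT R -> \bar R).
Proof.
move=> u0; apply: (@ge0_emeasurable_sum _ _ _ _ _ xpredT).
  by move=> m x _ _; exact: Uterm_ge0.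
by move=> m _; exact: measurable_Uterm.
Qed.

Lemma measurable_Ufun (R : realType) (u : nat -> nat -> R) :
  (forall n m, (n <= m)%N -> 0 <= u n m) ->
  measurable_fun (@dom R : set (LebT R)) (Ufun u : LebT R -> \bar R).
Proof.
move=> u0.
rewrite (_ : Ufun u = (fun x => \sum_(n <oo) \sum_(m <oo)
  if (n <= m)%N then (u n m)%:E * (Lnm n m x)%:E else 0)%E); last first.
  by apply/funext => x; exact: Ufun_nneseries.
apply: (@ge0_emeasurable_sum _ _ _ _ _ xpredT).
  by move=> n x _ _; apply: nneseries_ge0 => m _ _; exact: Uterm_ge0.
by move=> n _; exact: measurable_inner_series.
Qed.

(** Monotone convergence is used twice, for the series in n and then for the series in m. *)
Lemma integral_Ufun (R : realType) (u : nat -> nat -> R) :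
  (forall n m, (n <= m)%N -> 0 <= u n m) ->
  (\int[@completed_lebesgue_measure R]_(x in (@dom R : set (LebT R))) Ufun u x
   = 2%:E * \esum_(p in [set p : nat * nat | (p.1 <= p.2)%N])
       (loop_freq R p.1 p.2 * u p.1 p.2)%:E)%E.
Proof.
move=> u0.
have c0 p : (p.1 <= p.2)%N -> (0 <= (loop_freq R p.1 p.2 * u p.1 p.2)%:E)%E.
  by move=> p12; rewrite lee_fin mulr_ge0 ?loop_freq_ge0 ?u0.
rewrite esum_nneseries2 //.
have d0 n m : (0 <= if (n <= m)%N then (loop_freq R n m * u n m)%:E else 0)%E.
  by case: ifP => // /(c0 (n, m)).
transitivity (\int[@completed_lebesgue_measure R]_(x in (@dom R : set (LebT R)))
  (\sum_(n <oo) \sum_(m <oo)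
     if (n <= m)%N then (u n m)%:E * (Lnm n m x)%:E else 0))%E.
  by apply: eq_integral => x _; exact: Ufun_nneseries.
rewrite integral_nneseries; first last.
- by move=> n x _; apply: nneseries_ge0 => m _ _; exact: Uterm_ge0.
- by move=> n; exact: measurable_inner_series.
- exact: measurable_dom.
rewrite -nneseriesZl; last by move=> n _; apply: nneseries_ge0.
apply: eq_eseriesr => n _.
rewrite integral_nneseries; first last.
- by move=> m x _; exact: Uterm_ge0.
- by move=> m; exact: measurable_Uterm.
- exact: measurable_dom.
rewrite -nneseriesZl //; apply: eq_eseriesr => m _.
case: ifP => nm; last by rewrite integral0 mule0.
by rewrite integral_Lnm ?u0.
Qed.

(** * The essential supremum *)

Lemma Ufun_le_third (R : realType) (u : nat -> nat -> R) (x : R) :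
  (forall n m, (n <= m)%N -> 0 <= u n m) -> (Ufun u x <= Ufun u (1 / 3 : R))%E.
Proof.
move=> u0; apply: le_esum => p /= p12.
by rewrite lee_wpmul2l ?lee_fin ?u0 // Lnm_le_third.
Qed.

(** The measure lives on the whole line; the value [-oo] off [dom] keeps the points there from
    contributing. *)
Lemma ess_sup_Ufun (R : realType) (u : nat -> nat -> R) :
  (forall n m, (n <= m)%N -> 0 <= u n m) ->
  ess_sup (@completed_lebesgue_measure R)
    (fun x : LebT R => if x \in @dom R then Ufun u x else -oo)%E
  = Ufun u (1 / 3 : R).
Proof.
move=> u0; apply/eqP; rewrite eq_le; apply/andP; split.
  apply/ess_supP; apply: aeW => x.
  by case: ifP => _; [exact: Ufun_le_third | exact: leNye].
(* [Ufun u (1 / 3)] is a supremum of finite sums, so it suffices to bound the sum over a finite [F]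
   by any [y] that dominates U off a null set [N]. *)
apply: ge_ereal_sup => _ [F [finF FS] <-].
apply: le_ereal_inf_tmp => y [N [mN N0 fN]].
(* All windows in [F] lie within the first [M] digits. *)
have [M FM] : exists M, forall p, F p -> (p.2 < M)%N.
  move/finite_seqP: finF => [s ->].
  exists (\max_(p <- s) p.2).+1 => p pF.
  by rewrite ltnS; exact: (leq_bigmax_seq p).
(* The cylinder has measure 2 / 2^M > 0, so the null set [N] cannot contain it. *)
have [x [cx nNx]] : exists x, cyl R alt M x /\ ~ N x.
  apply: contrapT => H.
  have [mC C] := cyl_measure R alt M.
  have CN : (cyl R alt M : set (LebT R)) `<=` N.
    by move=> x cx; apply: contrapT => nNx; apply: H; exists x.
  have : (2 / 2 ^+ M)%:E = 0%E :> \bar R.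
    exact: etrans (esym C) (subset_measure0 mC mN CN N0).
  by move/eqP; rewrite eqe mulf_eq0 invr_eq0 expf_eq0 pnatr_eq0 andbF.
have [dx xalt] := cx.
have : ((if x \in @dom R then Ufun u x else -oo) <= y)%E.
  by apply: contrapT => H; apply: nNx; apply: fN.
rewrite mem_set //; apply: le_trans.
apply: ereal_sup_ubound; exists F; first by split.
(* [x] shares its first [M] digits with 1/3, so the terms indexed by [F] agree at both points. *)
apply: eq_fsbigr => p; rewrite inE => pF; congr (_ * _%:E)%E.
apply: eq_Lnm => j jp; rewrite sdigits_third xalt //.
exact: leq_ltn_trans (FM _ pF).
Qed.

Theorem theorem1 (R : realType) (u : nat -> nat -> R)
    (hu : forall n m : nat, (n <= m)%N -> 0 <= u n m) :
  let U := Ufun u in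
  [/\ (forall x, dom x -> (0 <= U x)%E),
      measurable_fun (@dom R : set (LebT R)) (U : LebT R -> \bar R),
      (forall x, dom x -> U (- x) = U x),
      (\int[@completed_lebesgue_measure R]_(x in (@dom R : set (LebT R))) U x
         = 2%:E * \sum_(1 <= k <oo)
             \esum_(p in [set p : nat * nat |
                          (p.1 <= p.2)%N /\ p.2 = (p.1 + (2 * k - 1))%N])
                ((4 ^- k * ('C(2 * k, k))%:R * u p.1 p.2)%:E))%E
    & [/\ dom (1 / 3 : R), dom (- (1 / 3) : R),
          ess_sup (@completed_lebesgue_measure R)
            (fun x : LebT R => if x \in @dom R then U x else -oo)%E = U (1 / 3),
          U (- (1 / 3)) = U (1 / 3)
        & U (1 / 3) = (\sum_(1 <= k <oo)
             \esum_(p in [set p : nat * nat |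
                          (p.1 <= p.2)%N /\ p.2 = (p.1 + (2 * k - 1))%N])
                (u p.1 p.2)%:E)%E]].
Proof.
move=> U.
have Ueven x : dom x -> U (- x) = U x.
  by move=> dx; apply: eq_esum => p _; rewrite LnmN.
have U0 x p : (p.1 <= p.2)%N -> (0 <= (u p.1 p.2)%:E * (Lnm p.1 p.2 x)%:E)%E.
  by move=> p12; rewrite mule_ge0 // lee_fin ?hu ?Lnm_ge0.
split.
- by move=> x _; apply: esum_ge0 => p; exact: U0.
- exact: measurable_Ufun.
- exact: Ueven.
- rewrite integral_Ufun // esum_odd_gap; first last.
  + by move=> p _ /negbTE o; rewrite /loop_freq o mul0r.
  + by move=> p p12; rewrite lee_fin mulr_ge0 ?loop_freq_ge0 ?hu.
  (* The lower bound 1 becomes a condition on [k]; at [k = 0] truncated subtraction would turn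
     [2 * k - 1] into the even gap 0. *)
  congr (_ * _)%E; rewrite !(eseries_cond _ _ 1).
  apply: eq_eseriesr => k /= k0; apply: eq_esum => p [_ ->].
  by rewrite loop_freq_odd.
split.
- exact: dom_third.
- exact: domN (dom_third R).
- exact: ess_sup_Ufun.
- exact: Ueven (dom_third R).
rewrite /U /Ufun esum_odd_gap; first last.
- by move=> p p12 o; rewrite Lnm_odd // mule0.
- exact: U0.
rewrite !(eseries_cond _ _ 1).
apply: eq_eseriesr => k /= k0; apply: eq_esum => p [_ pk].
by rewrite Lnm_third ?mule1 // pk; lia.
Qed.
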